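(* Let $Z\subseteq\{0,1\}^N$, let $n\ge k\geq 1$ be integers, and let $\mathcal G_1,\ldots,\mathcal G_n$ be extended learning graphs for Boolean functions $f_1,\ldots,f_n:Z\to\{0,1\}$ respectively. Let $f=\bigvee_{i\in[n]}f_i$, and assume that for every $x\in Z$ with $f(x)=1$ there are at least $k$ indices $i\in[n]$ with $f_i(x)=1$. Then there is an extended learning graph $\mathcal G$ for $f$ such that for every $z\in Z$: $$C^0(\mathcal G,z)\le \frac nk\times \mathop{\mathrm{Exp}}_{i\in[n]}\left(C^0(\mathcal G_i,z)\,C^1(\mathcal G_i)\right)\ \text{ when } f(z)=0,\qquad C^1(\mathcal G,z)\le 1\ \text{ when } f(z)=1,$$ where the expectation is over $i$ uniform in $[n]$.
   Context: For $S\subseteq[N]$, $z_S$ is the restriction of $z$ to the positions in $S$. A $1$-certificate for $f$ on $y\in f^{-1}(1)$ is a set $I\subseteq[N]$ such that $f(z)=1$ for every $z\in Z$ with $z_I=y_I$. Extended learning graph. Let $Y\subseteq Z\subseteq\{0,1\}^N$. An extended learning graph $\mathcal G$ is a $5$-tuple $(\mathcal V,\mathcal E,\mathcal S,\{w_z^b: z\in Z,b\in\{0,1\}\},\{p_y:y\in Y\})$ such that: (i) $(\mathcal V,\mathcal E)$ is a (finite) directed acyclic graph rooted at some $r\in\mathcal V$; (ii) $\mathcal S$ maps each $v\in\mathcal V$ to $\mathcal S(v)\subseteq[N]$, with $\mathcal S(r)=\emptyset$ and, for every $(u,v)\in\mathcal E$, $\mathcal S(v)=\mathcal S(u)\cup\{j\}$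 for some $j\notin\mathcal S(u)$; (iii) for every $(u,v)\in\mathcal E$, the weights $w_z^b(u,v)$ are in $\mathbb R_{\ge0}$ and depend on $z$ only through $z_{\mathcal S(v)}$; (iv) $w_x^0(u,v)=w_y^1(u,v)$ for all $x\in Z\setminus Y$, $y\in Y$ and $(u,v)\in\mathcal E$ with $\mathcal S(v)=\mathcal S(u)\cup\{j\}$, $x_{\mathcal S(u)}=y_{\mathcal S(u)}$ and $x_j\ne y_j$; (v) for every $y\in Y$, $p_y:\mathcal E\to\mathbb R_{\ge0}$ is a unit flow whose source is the root, with $p_y(e)=0$ whenever $w_y^1(e)=0$. $\mathcal G$ is an extended learning graph for $f:Z\to\{0,1\}$ if $Y=f^{-1}(1)$ and, for every $y\in Y$, the label of each sink of $p_y$ contains a $1$-certificate for $f$ on $y$. Complexity. For an extended learning graph $\mathcal G$ for $f$, $x\in f^{-1}(0)$ and $y\in f^{-1}(1)$: $C^0(\mathcal G,x)=\sum_{e\in\mathcal E}w_x^0(e)$, $C^1(\mathcal G,y)=\sum_{e\in\mathcal E}p_y(e)^2/w_y^1(e)$ (terms with $p_y(e)=0$ count as $0$), and $C^1(\mathcal G)=\max_{y\in f^{-1}(1)}C^1(\mathcal G,y)$ (the maximum over an empty set is $0$). *)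

(* Defs.v *)
From HB Require Import structures.
From mathcomp Require Import all_boot all_order all_algebra.
From mathcomp Require Import reals.

Set Implicit Arguments.
Unset Strict Implicit.
Unset Printing Implicit Defensive.

Import Order.TTheory GRing.Theory Num.Theory.
Local Open Scope ring_scope.

Notation cube N := {ffun 'I_N -> bool}.

(* A Boolean function Z -> {0,1} is given by a total f : cube N -> bool; every
   notion below only looks at its values on Z. *)
Definition ones (N : nat) (Z : {set cube N}) (f : cube N -> bool) :
  {set cube N} := [set z in Z | f z].

Definition agree (N : nat) (S : {set 'I_N}) (z z' : cube N) : Prop :=
  {in S, z =1 z'}.

Definition certificate1 (N : nat) (Z : {set cube N}) (f : cube N -> bool)
    (y : cube N) (I : {set 'I_N}) : Prop :=
  forall z, z \in Z -> agree I z y -> f z.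

(* Quantities on edges are functions on V * V; only their values on actual
   edges matter. *)
Definition inflow (R : realType) (V : finType) (E : rel V) (p : V * V -> R)
    (v : V) : R := \sum_(u | E u v) p (u, v).

Definition outflow (R : realType) (V : finType) (E : rel V) (p : V * V -> R)
    (v : V) : R := \sum_(u | E v u) p (v, u).

(* The only source is r, which emits one unit; any other vertex may conserve
   or absorb flow, the absorbing ones being the sinks. *)
Definition unit_flow (R : realType) (V : finType) (E : rel V) (r : V)
    (p : V * V -> R) : Prop :=
  [/\ forall u v, E u v -> 0 <= p (u, v),
      outflow E p r - inflow E p r = 1 &
      forall v, v != r -> outflow E p v <= inflow E p v].

Definition flow_sink (R : realType) (V : finType) (E : rel V)
    (p : V * V -> R) (v : V) : Prop := outflow E p v < inflow E p v.

Definition acyclic (V : finType) (E : rel V) : Prop :=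
  forall u v, E u v -> ~~ connect E v u.

Definition rooted_at (V : finType) (E : rel V) (r : V) : Prop :=
  forall v, connect E r v.

(* [lg_weight z b] is w_z^b, with b = false for 0 and b = true for 1; it is
   unconstrained for z outside Z, and so is [lg_flow y] for y outside Y. *)
Record extLG (R : realType) (N : nat) (Z Y : {set cube N}) := ExtLG {
  lg_vertex : finType;
  lg_edge : rel lg_vertex;
  lg_root : lg_vertex;
  lg_label : lg_vertex -> {set 'I_N};
  lg_weight : cube N -> bool -> lg_vertex * lg_vertex -> R;
  lg_flow : cube N -> lg_vertex * lg_vertex -> R;
  lg_sub : Y \subset Z;
  lg_acyclic : acyclic lg_edge;
  lg_rooted : rooted_at lg_edge lg_root;
  lg_label_root : lg_label lg_root = set0;
  lg_label_edge : forall u v, lg_edge u v ->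
    exists2 j, j \notin lg_label u & lg_label v = j |: lg_label u;
  lg_weight_ge0 : forall u v, lg_edge u v -> forall z b, z \in Z ->
    0 <= lg_weight z b (u, v);
  lg_weight_local : forall u v, lg_edge u v ->
    forall z z' b, z \in Z -> z' \in Z -> agree (lg_label v) z z' ->
    lg_weight z b (u, v) = lg_weight z' b (u, v);
  lg_weight_flip : forall u v j, lg_edge u v ->
    j \notin lg_label u -> lg_label v = j |: lg_label u ->
    forall x y, x \in Z :\: Y -> y \in Y ->
    agree (lg_label u) x y -> x j != y j ->
    lg_weight x false (u, v) = lg_weight y true (u, v);
  lg_flow_unit : forall y, y \in Y -> unit_flow lg_edge lg_root (lg_flow y);
  lg_flow_supp : forall y, y \in Y -> forall u v, lg_edge u v ->
    lg_weight y true (u, v) = 0 -> lg_flow y (u, v) = 0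
}.

Arguments lg_edge {R N Z Y} e _ _.
Arguments lg_root {R N Z Y} e.
Arguments lg_label {R N Z Y} e _.
Arguments lg_weight {R N Z Y} e _ _ _.
Arguments lg_flow {R N Z Y} e _ _.

Definition lg_for (R : realType) (N : nat) (Z : {set cube N})
    (f : cube N -> bool) (G : extLG R Z (ones Z f)) : Prop :=
  forall y, y \in ones Z f ->
  forall v, flow_sink (lg_edge G) (lg_flow G y) v ->
  exists2 I : {set 'I_N}, I \subset lg_label G v & certificate1 Z f y I.

Definition C0 (R : realType) (N : nat) (Z Y : {set cube N})
    (G : extLG R Z Y) (x : cube N) : R :=
  \sum_(e | lg_edge G e.1 e.2) lg_weight G x false e.

(* Division is total: a term with p_y(e) = 0 is 0 even when w_y^1(e) = 0. *)
Definition C1 (R : realType) (N : nat) (Z Y : {set cube N})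
    (G : extLG R Z Y) (y : cube N) : R :=
  \sum_(e | lg_edge G e.1 e.2)
    lg_flow G y e ^+ 2 / lg_weight G y true e.

(* [C1 G y] is nonnegative for y in Y, so starting the maximum at 0 only
   affects the case of an empty Y. *)
Definition C1max (R : realType) (N : nat) (Z Y : {set cube N})
    (G : extLG R Z Y) : R := \big[Num.max/0]_(y in Y) C1 G y.

Definition unif_exp (R : realType) (n : nat) (F : 'I_n -> R) : R :=
  (\sum_(i < n) F i) / n%:R.

(* Main.v *)
(* Glue the graphs G_i at their roots, scale the weights of G_i by C^1(G_i)/k,
   and for y with m >= k indices i such that f_i(y) = 1 send 1/m of the flow
   through each of the corresponding G_i. Then C^0 is the sum of the
   C^0(G_i, x) C^1(G_i)/k, and C^1 at y is at most m * (1/m^2) * k = k/m <= 1;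
   the scaling is nonzero wherever flow is used because a unit flow has positive
   C^1. The one subtlety is condition (iv), which now also concerns points y
   with f(y) = 1 but f_i(y) = 0: the 1-weights of G_i carry no flow there, and
   they are redefined as the 0-weights that (iv) prescribes. *)
Require Import Defs.
From mathcomp Require Import all_boot all_order all_algebra.
From mathcomp Require Import reals.

Set Implicit Arguments.
Unset Strict Implicit.
Unset Printing Implicit Defensive.

Import Order.TTheory GRing.Theory Num.Theory.
Local Open Scope ring_scope.

(** * Gluing a family of rooted graphs at their roots *)

Section Wedge.
Context (R : realType) (I : finType) (V : I -> finType).
Context (r : forall i, V i) (E : forall i, rel (V i)).
Hypothesis root_no_pred : forall i (u : V i), E u (r i) = false.

Definition nonroot (i : I) := {v : V i | v != r i}.

(* The disjoint union of the [V i] with all roots identified to [None]. *)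
Definition wedge := option {i : I & nonroot i}.

Definition wedge_in (i : I) (v : V i) : wedge :=
  omap (Tagged nonroot) (insub v).

(* Collapses the other summands to the root of [V i]. *)
Definition wedge_out (i : I) (a : wedge) : V i :=
  if a is Some x then untag (T_ := nonroot) (r i) val x else r i.

(** The head of an edge is never the common root, so it determines the summand [i]; the equality
    test then says that the tail also lies in summand [i], possibly as the root. *)
Definition wedge_edge (a b : wedge) : bool :=
  if b is Some x then
    let i := tag x in
    (a == wedge_in (wedge_out i a)) && E (wedge_out i a) (val (tagged x))
  else false.

(** The summand is read off the head because the tail may be the shared root. The default [t0] is
    reached only on pairs that are not edges. *)
Definition wedge_fun (T : Type) (t0 : T) (W : forall i, V i * V i -> T)
    (e : wedge * wedge) : T :=
  if e.2 is Some x then @W (tag x) (wedge_out (tag x) e.1, val (tagged x))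
  else t0.

Lemma wedge_in_root i : wedge_in (r i) = None.
Proof. by rewrite /wedge_in insubF ?eqxx. Qed.

Lemma wedge_inE i v (vr : v != r i) :
  wedge_in v = Some (Tagged nonroot (exist _ v vr)).
Proof. by rewrite /wedge_in insubT. Qed.

Lemma wedge_inK i : cancel (@wedge_in i) (wedge_out i).
Proof.
move=> v; case: (eqVneq v (r i)) => [->|vr]; first by rewrite wedge_in_root.
rewrite (wedge_inE vr) /=.
exact: (untagE _ _ (erefl : tag (Tagged nonroot (exist _ v vr)) = i)).
Qed.

Lemma wedge_out_neq i j (v : V j) : j != i -> wedge_out i (wedge_in v) = r i.
Proof.
move=> ji; case: (eqVneq v (r j)) => [->|vr]; first by rewrite wedge_in_root.
by rewrite (wedge_inE vr) /= untag_dflt.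
Qed.

Lemma wedge_in_eq_None i (v : V i) : (wedge_in v == None) = (v == r i).
Proof.
case: (eqVneq v (r i)) => [->|vr]; first by rewrite wedge_in_root.
by rewrite (wedge_inE vr).
Qed.

Lemma wedgeP (a : wedge) :
  a = None \/ exists i (v : V i), v != r i /\ a = wedge_in v.
Proof.
case: a => [[i [v vr]]|]; last by left.
by right; exists i, v; split=> //; rewrite (wedge_inE vr).
Qed.

Lemma wedge_edge_to a i v :
  wedge_edge a (@wedge_in i v) =
  (a == wedge_in (wedge_out i a)) && E (wedge_out i a) v.
Proof.
case: (eqVneq v (r i)) => [->|vr]; last by rewrite (wedge_inE vr).
by rewrite wedge_in_root root_no_pred andbF.
Qed.

Lemma wedge_edge_in i u v : wedge_edge (wedge_in u) (@wedge_in i v) = E u v.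
Proof. by rewrite wedge_edge_to wedge_inK eqxx. Qed.

Lemma wedge_edge_root i v : wedge_edge None (@wedge_in i v) = E (r i) v.
Proof. by rewrite -(wedge_in_root i) wedge_edge_in. Qed.

Lemma wedge_edge_neq i j u v :
  i != j -> u != r i -> wedge_edge (@wedge_in i u) (@wedge_in j v) = false.
Proof.
move=> ij ur; rewrite wedge_edge_to wedge_out_neq // wedge_in_root.
by rewrite wedge_in_eq_None (negPf ur).
Qed.

Lemma wedge_edgeP a b : wedge_edge a b ->
  exists i (u v : V i), [/\ E u v, a = wedge_in u & b = wedge_in v].
Proof.
case: (wedgeP b) => [->|[i [v [vr ->]]]] //.
by rewrite wedge_edge_to => /andP[/eqP ? ?]; exists i, (wedge_out i a), v.
Qed.

Lemma edge_target_neq i (u v : V i) : E u v -> v != r i.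
Proof. by apply: contraTneq => ->; rewrite root_no_pred. Qed.

Lemma wedge_funE T (t0 : T) W i (u v : V i) : E u v ->
  wedge_fun t0 W (wedge_in u, wedge_in v) = W i (u, v).
Proof.
by move/edge_target_neq => vr; rewrite /wedge_fun (wedge_inE vr) /= wedge_inK.
Qed.

Lemma wedge_sum (g : wedge -> R) :
  \sum_a g a = g None + \sum_i \sum_(v | v != r i) g (@wedge_in i v).
Proof.
rewrite (bigD1 None) //=; congr (_ + _).
rewrite (reindex_omap (@Some _) id) => [|[]//].
rewrite (eq_bigl xpredT) => [|x]; last by rewrite eqxx.
transitivity (\sum_i \sum_(v : nonroot i) g (Some (Tagged nonroot v))).
  rewrite (@sig_big_dep _ _ _ I (fun i => nonroot i : finType) xpredT
    (fun=> xpredT) (fun i v => g (Some (Tagged nonroot v)))) /=.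
  by apply: eq_bigr => -[].
apply: eq_bigr => i _; rewrite (big_sub (fun v => v != r i)).
by apply: eq_bigr => -[v vr] _ /=; rewrite (wedge_inE vr).
Qed.

Lemma wedge_connect i u v :
  connect (@E i) u v -> connect wedge_edge (wedge_in u) (wedge_in v).
Proof.
case/connectP => s Es ->; apply/connectP; exists (map (@wedge_in i) s).
  by apply: homo_path Es => x y; rewrite wedge_edge_in.
by rewrite last_map.
Qed.

Lemma wedge_rooted :
  (forall i, rooted_at (@E i) (r i)) -> rooted_at wedge_edge None.
Proof.
move=> Er a; case: (wedgeP a) => [->|[i [v [_ ->]]]]; first exact: connect0.
by rewrite -(wedge_in_root i); exact: wedge_connect (Er i v).
Qed.

(** * Flows and edge sums on the glued graph *)

Section Flow.
Variable p : forall i, V i * V i -> R.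
Let q := wedge_fun 0 p.

Lemma wedge_inflow_root : inflow wedge_edge q None = 0.
Proof. exact: big_pred0. Qed.

(** All predecessors of a vertex of summand [i] lie in that summand, and the root has none, so [v]
    may even be the root. For outflow the root must be treated apart: its successors spread over all
    summands. *)
Lemma wedge_inflow i v : inflow wedge_edge q (@wedge_in i v) =
  inflow (@E i) (@p i) v.
Proof.
rewrite /inflow (reindex_onto (@wedge_in i) (wedge_out i)) /=.
  apply: eq_big => [u|u]; rewrite wedge_edge_in wedge_inK eqxx andbT //.
  exact: wedge_funE.
by move=> a; rewrite wedge_edge_to => /andP[/eqP/esym].
Qed.

Lemma wedge_outflow_root :
  outflow wedge_edge q None = \sum_i outflow (@E i) (@p i) (r i).
Proof.
rewrite /outflow big_mkcond wedge_sum add0r; apply: eq_bigr => i _.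
rewrite -big_mkcondr; apply: eq_big => [v|v /andP[_]]; rewrite wedge_edge_root.
  by case: (boolP (E _ _)) => [/edge_target_neq->|]; rewrite ?andbF.
by move/(wedge_funE 0 p); rewrite wedge_in_root.
Qed.

Lemma wedge_outflow i u : u != r i ->
  outflow wedge_edge q (@wedge_in i u) = outflow (@E i) (@p i) u.
Proof.
move=> ur; rewrite /outflow big_mkcond wedge_sum add0r (bigD1 i) //=.
rewrite [X in _ + X]big1 ?addr0 => [|j ji]; last first.
  by rewrite big1 // => v _; rewrite wedge_edge_neq // eq_sym.
rewrite -big_mkcondr; apply: eq_big => [v|v /andP[_]]; rewrite wedge_edge_in.
  by case: (boolP (E _ _)) => [/edge_target_neq->|]; rewrite ?andbF.
exact: wedge_funE.
Qed.

Lemma wedge_edge_sum : \sum_(e | wedge_edge e.1 e.2) q e =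
  \sum_i \sum_(e | E e.1 e.2) @p i e.
Proof.
(* Edges are grouped by head; [inflow] is applied here to an arbitrary edge function. Grouping by
   head loses nothing at the root, which has no incoming edge. *)
have sumE (T : finType) (D : rel T) (F : T * T -> R) :
    \sum_(e | D e.1 e.2) F e = \sum_b inflow D F b.
  rewrite /inflow (exchange_big_dep xpredT) //= pair_big_dep /=.
  by apply: eq_big => [[]|[]].
rewrite sumE wedge_sum wedge_inflow_root add0r; apply: eq_bigr => i _.
rewrite sumE [RHS](bigD1 (r i)) //= [inflow _ _ (r i)]big_pred0 ?add0r //.
by apply: eq_bigr => v _; rewrite wedge_inflow.
Qed.

End Flow.
End Wedge.

(** * Roots and positivity of the 1-complexity in a learning graph *)

Section LearningGraph.
Context (R : realType) (N : nat) (Z Y : {set cube N}) (G : extLG R Z Y).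

Lemma lg_label_card u v : lg_edge G u v ->
  #|lg_label G v| = #|lg_label G u|.+1.
Proof. by case/lg_label_edge => j jLu ->; rewrite cardsU1 jLu. Qed.

(** The label of the root is empty, whereas the head of an edge has a nonempty label. This is what
    permits gluing at the roots. *)
Lemma lg_root_no_pred u : lg_edge G u (lg_root G) = false.
Proof.
by apply: contraTF isT => /lg_label_card; rewrite lg_label_root cards0.
Qed.

Lemma lg_outflow_root y : y \in Y ->
  outflow (lg_edge G) (lg_flow G y) (lg_root G) = 1.
Proof.
move=> yY; have [_ <- _] := lg_flow_unit G yY.
by rewrite [inflow _ _ _]big_pred0 ?subr0 // => u; apply: lg_root_no_pred.
Qed.

(** One unit leaves the root, so some edge there carries nonzero flow; by the support condition its
    weight is nonzero, and its term is positive while the others are nonnegative. *)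
Lemma C1_gt0 y : y \in Y -> 0 < C1 G y.
Proof.
move=> yY.
have w0 u v (Euv : lg_edge G u v) : 0 <= lg_weight G y true (u, v).
  exact: lg_weight_ge0 Euv _ true (subsetP (lg_sub G) _ yY).
have term0 e : lg_edge G e.1 e.2 ->
    0 <= lg_flow G y e ^+ 2 / lg_weight G y true e.
  by case: e => u v /w0 ?; rewrite divr_ge0 ?sqr_ge0.
have [v Erv pv] : exists2 v, lg_edge G (lg_root G) v &
    lg_flow G y (lg_root G, v) != 0.
  apply/exists_inP; apply: contraT => /exists_inPn p_eq0.
  move: (lg_outflow_root yY); rewrite [outflow _ _ _]big1 => [/esym/eqP|v /p_eq0 /negPn/eqP//].
  by rewrite oner_eq0.
rewrite /C1 (bigD1 (lg_root G, v)) //=; apply: ltr_wpDr.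
  by apply: sumr_ge0 => e /andP[/term0].
apply: divr_gt0; first by rewrite exprn_even_gt0.
rewrite lt0r w0 // andbT; apply: contra_neq pv.
exact: lg_flow_supp.
Qed.

Lemma C1max_ge0 : 0 <= C1max G.
Proof. exact: bigmax_ge_id. Qed.

Lemma C1_le_max y : y \in Y -> C1 G y <= C1max G.
Proof. exact: le_bigmax_cond. Qed.

Lemma C1max_gt0 y : y \in Y -> 0 < C1max G.
Proof. by move=> yY; apply: lt_le_trans (C1_gt0 yY) (C1_le_max yY). Qed.

(** * Adapting the 1-weights to a larger set of ones *)

Section EnlargeOnes.
Variable Y' : {set cube N}.

(** The premises of (iv) on the edge [e], with [z] as the 1-point. The flipped coordinate is
    recovered as the only element of the label difference. *)
Definition edge_flip (e : lg_vertex G * lg_vertex G) (z x : cube N) : bool :=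
  [forall j in lg_label G e.1, x j == z j] &&
  [exists j in lg_label G e.2 :\: lg_label G e.1, x j != z j].

(* Condition (iv) for [Y'] forces the 1-weights also at points of [Y' :\: Y],
   where [G] leaves them free. *)
Definition flip_weight (z : cube N) (b : bool) e : R :=
  if b then
    if [pick x in Z :\: Y' | edge_flip e z x] is Some x
    then lg_weight G x false e else lg_weight G z true e
  else lg_weight G z false e.

Lemma edge_flipP u v j z x : j \notin lg_label G u ->
  lg_label G v = j |: lg_label G u ->
  reflect (agree (lg_label G u) x z /\ x j != z j) (edge_flip (u, v) z x).
Proof.
move=> ju Lv; apply: (iffP andP) => -[/= xz xzj]; split.
- by move=> l lu; apply/eqP; move/forall_inP: xz; apply.
- case/exists_inP: xzj => l; rewrite Lv !inE.
  by case: eqP => [->|_] //=; rewrite andNb.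
- by apply/forall_inP => l /xz /eqP.
- by apply/exists_inP; exists j; rewrite // Lv !inE eqxx andbT.
Qed.

Lemma flip_weight_ge0 u v z b : lg_edge G u v -> z \in Z ->
  0 <= flip_weight z b (u, v).
Proof.
move=> Euv zZ; rewrite /flip_weight; case: b; last exact: lg_weight_ge0.
case: pickP => [x /andP[/setDP[xZ _] _]|_]; exact: lg_weight_ge0.
Qed.

(** The candidates [x] depend on [z] only through the label of [v], so the same [x] is picked for
    [z] and [z']. *)
Lemma flip_weight_local u v z z' b : lg_edge G u v -> z \in Z -> z' \in Z ->
  agree (lg_label G v) z z' -> flip_weight z b (u, v) = flip_weight z' b (u, v).
Proof.
move=> Euv zZ z'Z zz'; rewrite /flip_weight; case: b; last first.
  exact: lg_weight_local zz'.
have [j ju Lv] := lg_label_edge Euv.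
have -> : [pick x in Z :\: Y' | edge_flip (u, v) z x] =
          [pick x in Z :\: Y' | edge_flip (u, v) z' x].
  apply: eq_pick => x; congr (_ && _).
  congr (_ && _).
    apply: eq_forallb_in => l lu; rewrite zz' //.
    by rewrite Lv !inE lu orbT.
  by apply: eq_existsb_in => l /setDP[lv _]; rewrite zz'.
by case: pickP => // _; apply: lg_weight_local zz'.
Qed.

(** The picked [x'] need not be [x], but both agree with [y] on the label of [u] and differ from it
    at [j]. Bits being binary, they agree on the label of [v], and locality equates their
    weights. *)
Lemma flip_weight_flip u v j x y : lg_edge G u v ->
  j \notin lg_label G u -> lg_label G v = j |: lg_label G u ->
  x \in Z :\: Y' -> agree (lg_label G u) x y -> x j != y j ->
  flip_weight x false (u, v) = flip_weight y true (u, v).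
Proof.
move=> Euv ju Lv xZ xy xyj; rewrite /flip_weight.
case: pickP => [x' /andP[x'Z /(edge_flipP _ _ ju Lv)[x'y x'yj]]|none].
  apply: lg_weight_local => //; try by case/setDP: xZ; case/setDP: x'Z.
  move=> l; rewrite Lv => /setU1P[->|lu]; last by rewrite xy ?x'y.
  by move: xyj x'yj; case: (x j) (x' j) (y j) => [] [] [].
move: (none x); rewrite xZ /= => /negP[]; exact/(edge_flipP _ _ ju Lv).
Qed.

(** A point outside [Y'] is outside [Y], so (iv) for [G] already gives the redefined value. *)
Lemma flip_weight_true u v y : lg_edge G u v -> Y \subset Y' -> y \in Y ->
  flip_weight y true (u, v) = lg_weight G y true (u, v).
Proof.
move=> Euv YY' yY; rewrite /flip_weight; case: pickP => // x /andP[xZ].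
have [j ju Lv] := lg_label_edge Euv.
case/(edge_flipP _ _ ju Lv); apply: lg_weight_flip => //.
by apply: subsetP xZ; apply: setDS.
Qed.

End EnlargeOnes.
End LearningGraph.

(** * Acyclicity from label sizes, and assembly of the graph for the disjunction *)

Lemma acyclic_card (V : finType) (E : rel V) (T : finType)
    (L : V -> {set T}) :
  (forall u v, E u v -> #|L v| = #|L u|.+1) -> acyclic E.
Proof.
move=> EL u v Euv; apply/connectP => -[s Es def_u].
(* Label sizes never decrease along the supposed path from [v] back to [u]. *)
suff: (#|L v| <= #|L u|)%N by rewrite (EL _ _ Euv) ltnn.
rewrite {}def_u; elim: s v Es {Euv} => //= w s IHs v /andP[/EL Lw /IHs].
by rewrite Lw; apply: ltnW.
Qed.

Theorem lemma4p1 (R : realType) (N : nat) (Z : {set cube N}) (n k : nat)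
    (hk : (1 <= k)%N) (hkn : (k <= n)%N)
    (f : 'I_n -> cube N -> bool)
    (Gs : forall i : 'I_n, extLG R Z (ones Z (f i)))
    (hGs : forall i : 'I_n, lg_for (Gs i))
    (F : cube N -> bool)
    (hF : forall z : cube N, z \in Z -> F z = [exists i : 'I_n, f i z])
    (hcard : forall x : cube N, x \in Z -> F x ->
       (k <= #|[set i : 'I_n | f i x]|)%N) :
  exists G : extLG R Z (ones Z F),
    lg_for G /\
    forall z : cube N, z \in Z ->
      (F z = false ->
         C0 G z <= n%:R / k%:R *
           unif_exp (fun i : 'I_n => C0 (Gs i) z * C1max (Gs i))) /\
      (F z = true -> C1 G z <= 1).
Proof.
pose Y := ones Z F; pose V i := lg_vertex (Gs i); pose r i := lg_root (Gs i).
pose E i : rel (V i) := lg_edge (Gs i).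
have noE i (u : V i) : E i u (r i) = false by apply: lg_root_no_pred.
pose WE := @wedge_edge 'I_n V r E.
(* If [f i] has no ones in [Z], then [C1max (Gs i)] is 0 and the whole copy gets weight 0; it
   carries no flow either. *)
pose w z b i (e : V i * V i) :=
  C1max (Gs i) / k%:R * flip_weight Y z b e.
pose m y : R := #|[set i | f i y]|%:R.
pose p y i (e : V i * V i) := if f i y then lg_flow (Gs i) y e / m y else 0.
pose W z b := wedge_fun (r := r) 0 (@w z b).
pose P y := wedge_fun (r := r) 0 (@p y).
pose L (a : wedge r) :=
  if a is Some x then lg_label (Gs (tag x)) (val (tagged x)) else set0.
have k_gt0 : 0 < k%:R :> R by rewrite ltr0n.
have n_gt0 : (0 < n)%N := leq_trans hk hkn.
have sum_m y c : \sum_(i | f i y) c = m y * c.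
  rewrite sumr_const mulr_natl; congr (_ *+ _).
  by apply: eq_card => i; rewrite inE.
have YF i : ones Z (f i) \subset Y.
  apply/subsetP => z; rewrite !inE => /andP[zZ fz]; rewrite zZ hF //.
  by apply/existsP; exists i.
have m_ge y : y \in Y -> k%:R <= m y.
  by rewrite inE => /andP[yZ /hcard]; rewrite ler_nat; apply.
have m_gt0 y : y \in Y -> 0 < m y by move/m_ge; apply: lt_le_trans.
have LE i (v : V i) : L (wedge_in r v) = lg_label (Gs i) v.
  case: (eqVneq v (r i)) => [->|vr]; last by rewrite (wedge_inE vr).
  by rewrite wedge_in_root lg_label_root.
have onesE i y : y \in Y -> (y \in ones Z (f i)) = f i y.
  by rewrite !inE => /andP[->].
have s_ge0 i : 0 <= C1max (Gs i) / k%:R.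
  by rewrite divr_ge0 ?C1max_ge0 // ltW.
have out_p y i v : f i y -> outflow (E i) (p y i) v =
    outflow (lg_edge (Gs i)) (lg_flow (Gs i) y) v / m y.
  by move=> fy; rewrite /outflow mulr_suml; apply: eq_bigr => u _; rewrite /p fy.
have in_p y i v : f i y -> inflow (E i) (p y i) v =
    inflow (lg_edge (Gs i)) (lg_flow (Gs i) y) v / m y.
  by move=> fy; rewrite /inflow mulr_suml; apply: eq_bigr => u _; rewrite /p fy.
have out_p0 y i v : ~~ f i y -> outflow (E i) (p y i) v = 0.
  by move=> fy; apply: big1 => u _; rewrite /p (negPf fy).
have in_p0 y i v : ~~ f i y -> inflow (E i) (p y i) v = 0.
  by move=> fy; apply: big1 => u _; rewrite /p (negPf fy).
have Gsub : Y \subset Z by apply/subsetP => z; rewrite inE => /andP[].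
have Grooted : rooted_at WE None.
  by apply: wedge_rooted => // i; apply: lg_rooted.
have Glabel a b : WE a b -> exists2 j, j \notin L a & L b = j |: L a.
  case/(wedge_edgeP noE) => i [u [v [Euv -> ->]]].
  by rewrite !LE; apply: lg_label_edge.
have Gacyclic : acyclic WE.
  by apply: (@acyclic_card _ _ _ L) => a b /Glabel[j ja ->]; rewrite cardsU1 ja.
have Gw_ge0 a b : WE a b -> forall z c, z \in Z -> 0 <= W z c (a, b).
  case/(wedge_edgeP noE) => i [u [v [Euv -> ->]]] z c zZ.
  by rewrite /W (wedge_funE noE _ _ Euv) // mulr_ge0 // flip_weight_ge0.
have Gw_local a b : WE a b -> forall z z' c, z \in Z -> z' \in Z ->
    agree (L b) z z' -> W z c (a, b) = W z' c (a, b).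
  case/(wedge_edgeP noE) => i [u [v [Euv -> ->]]] z z' c zZ z'Z.
  rewrite LE /W !(wedge_funE noE _ _ Euv) // => zz'; congr (_ * _).
  exact: flip_weight_local.
have Gw_flip a b j : WE a b -> j \notin L a -> L b = j |: L a ->
    forall x y, x \in Z :\: Y -> y \in Y -> agree (L a) x y -> x j != y j ->
    W x false (a, b) = W y true (a, b).
  case/(wedge_edgeP noE) => i [u [v [Euv -> ->]]].
  rewrite !LE => ju Lv x y xZ yY xy xyj.
  rewrite /W !(wedge_funE noE _ _ Euv) //; congr (_ * _).
  exact: flip_weight_flip xy xyj.
have Gflow y : y \in Y -> unit_flow WE None (P y).
  move=> yY; have m0 := m_gt0 y yY; split.
  - move=> a b /(wedge_edgeP noE)[i [u [v [Euv -> ->]]]].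
    rewrite /P (wedge_funE noE _ _ Euv) // /p; case: ifP => // fy.
    apply: divr_ge0; last exact: ltW.
    by have [|p_ge0 _ _] := @lg_flow_unit _ _ _ _ (Gs i) y;
      [rewrite onesE | apply: p_ge0].
  - rewrite wedge_inflow_root subr0 wedge_outflow_root //.
    (* Each of the [m y] active copies emits [1 / m y] from the common root. *)
    rewrite (eq_bigr (fun i => if f i y then (m y)^-1 else 0)) => [|i _].
      by rewrite -big_mkcond sum_m mulfV // gt_eqF.
    case: ifPn => fy; last exact: out_p0.
    by rewrite out_p // lg_outflow_root ?onesE // div1r.
  - move=> a; case: (wedgeP a) => [->|[i [v [vr ->]]]]; first by rewrite eqxx.
    rewrite wedge_inflow // wedge_outflow // => _.
    case: (boolP (f i y)) => fy; last by rewrite out_p0 ?in_p0.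
    have [|_ _] := @lg_flow_unit _ _ _ _ (Gs i) y; first by rewrite onesE.
    by rewrite out_p // in_p // ler_pM2r ?invr_gt0 //; apply.
have Gsupp y : y \in Y -> forall a b, WE a b ->
    W y true (a, b) = 0 -> P y (a, b) = 0.
  move=> yY a b /(wedge_edgeP noE)[i [u [v [Euv -> ->]]]].
  rewrite /W /P !(wedge_funE noE _ _ Euv) // /w /p; case: ifP => // fy.
  have yYi : y \in ones Z (f i) by rewrite onesE.
  rewrite flip_weight_true // => /eqP; rewrite mulf_eq0 gt_eqF /=; last first.
    by rewrite divr_gt0 ?(C1max_gt0 (Gs i) yYi).
  by move/eqP/(lg_flow_supp yYi Euv) => ->; rewrite mul0r.
exists (ExtLG Gsub Gacyclic Grooted erefl Glabel Gw_ge0 Gw_local Gw_flip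
  Gflow Gsupp); split.
  move=> y yY a; rewrite /flow_sink /=.
  case: (wedgeP a) => [->|[i [v [vr ->]]]].
    (* The common root emits a net unit, so it is not a sink. *)
    have [_ p1 _] := Gflow y yY.
    by rewrite -subr_gt0 -opprB p1 oppr_gt0 ltr10.
  rewrite wedge_inflow // wedge_outflow // LE.
  case: (boolP (f i y)) => fy; last by rewrite out_p0 ?in_p0 ?ltxx.
  rewrite out_p // in_p // ltr_pM2r ?invr_gt0 ?m_gt0 //.
  case/hGs => [|C CL Cy]; first by rewrite onesE.
  (* A certificate for [f i] certifies [F], since [f i] implies [F] on [Z]. *)
  exists C => // z zZ /(Cy z zZ) fz; rewrite hF //.
  by apply/existsP; exists i.
move=> z zZ; split=> Fz.
  (* This bound is an equality: the factor [n] cancels the averaging, and [flip_weight] leaves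
     0-weights unchanged. *)
  rewrite /C0 /= (wedge_edge_sum noE) /unif_exp [leRHS]mulrC mulrA.
  rewrite divfK ?pnatr_eq0 -?lt0n // mulr_suml ler_sum // => i _.
  by rewrite -mulr_sumr -[leRHS]mulrA [leRHS]mulrC lexx.
have zY : z \in Y by rewrite inE zZ.
have m0 := m_gt0 z zY.
rewrite /C1 /=.
pose c i (e : V i * V i) := p z i e ^+ 2 / w z true i e.
rewrite (eq_bigr (wedge_fun 0 c))  => [|[a [x|]] //].
rewrite (wedge_edge_sum noE).
apply: (@le_trans _ _ (\sum_(i | f i z) (m z)^-1 ^+ 2 * k%:R)).
  rewrite [leRHS]big_mkcond ler_sum // => i _; rewrite /c /p /w.
  case: ifPn => fz; last by rewrite big1 // => e _; rewrite expr0n mul0r.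
  have zYi : z \in ones Z (f i) by rewrite onesE.
  (* Scaling the flow by [1 / m z] and the weight by [C1max (Gs i) / k] multiplies each term by this
     constant; [C1 <= C1max] then leaves at most [k / (m z)^2] per active copy. *)
  rewrite (eq_bigr (fun e => (m z)^-1 ^+ 2 * (k%:R / C1max (Gs i)) *
      (lg_flow (Gs i) z e ^+ 2 / lg_weight (Gs i) z true e))); last first.
    case=> u v Euv; rewrite flip_weight_true // exprMn invfM invf_div.
    by rewrite [_ ^+ 2 * _]mulrC mulrACA.
  rewrite -mulr_sumr -/(C1 (Gs i) z) -mulrA ler_pM2l ?exprn_gt0 ?invr_gt0 //.
  by rewrite mulrAC ler_pdivrMr ?(C1max_gt0 _ zYi) // ler_pM2l // C1_le_max.
rewrite sum_m mulrA expr2 mulVKf ?gt_eqF //.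
by rewrite mulrC ler_pdivrMr // mul1r m_ge.
Qed.
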